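(* Let $B$ be a Banach space, $D\subset B$ a dense subspace which is itself a Banach space with $\|\cdot\|_D\ge\|\cdot\|_B$. Let $M$ be a convex and bounded subset of $B^*$, $\sup_{\mu\in M}\|\mu\|_{B^*}\le M_0$, closed in the norm topologies of both $B^*$ and $D^*$. Let $T>0$, $\mu\in M$, and for $t\in[0,T]$, $\{\xi_\cdot\}\in C_\mu([0,T],M(D^* ))$ let $A[t,\{\xi_\cdot\}]:D\to B$ be linear operators such that: (i) there is a constant $c_1>0$ with, for all $\{\xi_\cdot\},\{\eta_\cdot\}\in C_\mu([0,T],M(D^* ))$, $$\sup_{t\in[0,T]}\|A[t,\{\xi_\cdot\}]-A[t,\{\eta_\cdot\}]\|_{D\to B}\le c_1\sup_{t\in[0,T]}\|\xi_t-\eta_t\|_{D^*},\qquad \sup_{t\in[0,T]}\|A[t,\{\xi_\cdot\}]\|_{D\to B}\le c_1;$$ (ii) for every $\{\xi_\cdot\}\in C_\mu([0,T],M(D^* ))$ the operator curve $A[t,\{\xi_\cdot\}]:D\to B$ generates a strongly continuous backward propagator $U^{t,s}[\{\xi_\cdot\}]$, $0\le t\le s\le T$, of bounded linear operators in $B$ on the common invariant domain $D$, with $\|U^{t,s}[\{\xi_\cdot\}]\|_{D\to D}\le c_2$, $\|U^{t,s}[\{\xi_\cdot\}]\|_{B\to B}\le c_3$ for positive constants $c_2,c_3$, and with dual propagators $\tilde U^{s,t}[\{\xi_\cdot\}]$ preserving $M$; (iii) for any $t$ from a dense subset of $[0,T]$, the set $\{\tilde U^{t,0}[\{\xi_\cdot\}]\mu:\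 \{\xi_\cdot\}\in C_\mu([0,T],M(D^* ))\}$ is relatively compact in $M$. Then there exists a solution $\mu_t\in M$, $t\in[0,T]$, of the nonlinear Cauchy problem $$\frac{d}{dt}(f,\mu_t)=(A[t,\{\mu_s\}_{s\in[0,T]}]f,\mu_t),\qquad \mu_0=\mu,$$ holding for all $f\in D$.
   Context: $C_\mu([0,T],M(D^* ))$ is the set of curves $[0,T]\to M$, continuous in the norm of $D^*$, with value $\mu$ at time $0$, with distance $\sup_t\|\xi_t-\eta_t\|_{D^*}$. $(f,\mu)$ is the duality pairing between $B$ and $B^*$. A backward propagator is a family $U^{t,r}$, $t\le r$, with $U^{t,t}=\mathrm{Id}$, $U^{t,s}U^{s,r}=U^{t,r}$ for $t\le s\le r$; strongly continuous means strongly continuous in $t$ and $r$. A family $L_t:D\to B$ of bounded linear operators generates $U^{t,r}$ on the invariant domain $D$ if for $f\in D$, $\frac{d}{ds}U^{t,s}f=U^{t,s}L_sf$ and $\frac{d}{ds}U^{s,r}f=-L_sU^{s,r}f$ for $t\le s\le r$ (derivatives in the norm of $B$, one-sided at end points). Generators are assumed to depend strongly continuously on $t$. The dual propagator is $\tilde U^{s,t}=(U^{t,s})^*:B^*\to B^*$. Relative compactness in $M$ is understood with respect to the norm topology of $D^*$. *)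

(* Defs.v *)
From HB Require Import structures.
From mathcomp Require Import all_boot all_order all_algebra.
From mathcomp Require Import all_classical all_reals all_analysis.

Set Implicit Arguments.
Unset Strict Implicit.
Unset Printing Implicit Defensive.

Import Order.TTheory GRing.Theory Num.Theory.
Import numFieldNormedType.Exports.

Local Open Scope classical_set_scope.
Local Open Scope ring_scope.

(* The normed space [bop V W] of bounded (i.e. continuous) linear operators,
   with the operator norm as its [`| _ |]. *)
Section BoundedOperators.
Context {R : realType} (V W : normedModType R).

Definition bop_pred : {pred V -> W} :=
  mem [set f : V -> W | linear f /\ continuous f].

Record bop : Type := Bop {
  bop_fun :> V -> W;
  bop_funP : bop_fun \in bop_pred
}.

HB.instance Definition _ := [isSub for bop_fun].
HB.instance Definition _ := [Choice of bop by <:].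

Lemma bop_predP (f : V -> W) :
  (f \in bop_pred) <-> (linear f /\ continuous f).
Proof. by rewrite /bop_pred inE. Qed.

Lemma bop_linear (f : bop) : linear f.
Proof. by have /bop_predP[] := bop_funP f. Qed.

Lemma bop_continuous (f : bop) : continuous f.
Proof. by have /bop_predP[] := bop_funP f. Qed.

HB.instance Definition _ (f : bop) :=
  GRing.isLinear.Build R V W *:%R (bop_fun f) (bop_linear f).

Lemma bop_submod_closed : submod_closed bop_pred.
Proof.
split=> [|a f g /bop_predP[lf cf] /bop_predP[lg cg]]; apply/bop_predP; split.
- by move=> k x y /=; rewrite scaler0 addr0.
- by move=> x; exact: cvg_cst.
- move=> k x y; rewrite /= !fctE /= lf lg.
  by rewrite !scalerDr !scalerA [a * k]mulrC -!addrA; congr (_ + _);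
    rewrite addrCA.
- by move=> x; apply: cvgD; [apply: cvgZr; exact: cf | exact: cg].
Qed.

HB.instance Definition _ :=
  GRing.isSubmodClosed.Build R (V -> W) bop_pred bop_submod_closed.
HB.instance Definition _ := [SubChoice_isSubLmodule of bop by <:].

Definition opnorm (f : bop) : R :=
  sup [set `|f x| | x in [set x : V | `|x| <= 1]].

Lemma bopD (f g : bop) x : (f + g) x = f x + g x.
Proof. by []. Qed.

Lemma bopZ (a : R) (f : bop) x : (a *: f) x = a *: f x.
Proof. by []. Qed.

Lemma opnorm_has_sup (f : bop) :
  has_sup [set `|f x| | x in [set x : V | `|x| <= 1]].
Proof.
split; first by exists `|f 0|; exists 0 => //=; rewrite normr0.
have := (@linear_bounded_continuous _ _ _ f).2 (@bop_continuous f).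
move=> /bounded_funP /(_ 1)[C fC].
by exists C => _ [x /= x1 <-]; exact: fC.
Qed.

Lemma opnorm_ge0 (f : bop) : 0 <= opnorm f.
Proof.
apply: (@le_trans _ _ `|f 0|) => //.
by apply: sup_upper_bound (opnorm_has_sup f) _ _; exists 0 => //=; rewrite normr0.
Qed.

Lemma opnormP (f : bop) x : `|f x| <= opnorm f * `|x|.
Proof.
have [->|x0] := eqVneq x 0; first by rewrite linear0 !normr0 mulr0.
have nx0 : 0 < `|x| by rewrite normr_gt0.
rewrite -ler_pdivrMr// mulrC.
have -> : `|x|^-1 * `|f x| = `|f (`|x|^-1 *: x)|.
  by rewrite linearZ normrZ ger0_norm// invr_ge0 ltW.
apply: sup_upper_bound (opnorm_has_sup f) _ _; exists (`|x|^-1 *: x) => //=.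
by rewrite normrZ ger0_norm ?invr_ge0 ?(ltW nx0)// mulVf// gt_eqF.
Qed.

Lemma opnorm_le (f : bop) (c : R) :
  0 <= c -> (forall x, `|f x| <= c * `|x|) -> opnorm f <= c.
Proof.
move=> c0 fc; apply: ge_sup; first by case: (opnorm_has_sup f).
by move=> _ [x /= x1 <-]; rewrite (le_trans (fc x))// ler_piMr.
Qed.

Lemma ler_opnormD (f g : bop) : opnorm (f + g) <= opnorm f + opnorm g.
Proof.
apply: opnorm_le => [|x]; first by rewrite addr_ge0// opnorm_ge0.
by rewrite bopD (le_trans (ler_normD _ _))// mulrDl lerD// opnormP.
Qed.

Lemma opnormZ_le (a : R) (f : bop) : opnorm (a *: f) <= `|a| * opnorm f.
Proof.
apply: opnorm_le => [|x]; first by rewrite mulr_ge0// opnorm_ge0.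
by rewrite bopZ normrZ -mulrA ler_wpM2l// opnormP.
Qed.

Lemma opnormZ (a : R) (f : bop) : opnorm (a *: f) = `|a| * opnorm f.
Proof.
apply/eqP; rewrite eq_le opnormZ_le /=.
have [->|a0] := eqVneq a 0; first by rewrite normr0 mul0r opnorm_ge0.
rewrite -ler_pdivlMl ?normr_gt0// -normfV.
by apply: le_trans (opnormZ_le _ _); rewrite scalerA mulVf// scale1r.
Qed.

Lemma opnorm0_eq0 (f : bop) : opnorm f = 0 -> f = 0.
Proof.
move=> f0; apply/val_inj/funext => x /=; apply/eqP; rewrite -normr_le0.
by rewrite (le_trans (opnormP f x))// f0 mul0r.
Qed.

HB.instance Definition _ :=
  Lmodule_isNormed.Build R bop ler_opnormD opnormZ opnorm0_eq0.

End BoundedOperators.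
Arguments bop_pred {R} V W.

Section Composition.
Context {R : realType} {U V W : normedModType R}.

Lemma bop_id_subproof : (@id V) \in bop_pred V V.
Proof. by apply/bop_predP; split=> // x. Qed.
Definition bop_id : bop V V := Bop bop_id_subproof.

Lemma bop_comp_subproof (g : bop V W) (f : bop U V) :
  (g \o f) \in bop_pred U W.
Proof.
apply/bop_predP; split=> [a x y|x] /=; first by rewrite !linearP.
by apply: continuous_comp; exact: bop_continuous.
Qed.
Definition bop_comp (g : bop V W) (f : bop U V) : bop U W :=
  Bop (bop_comp_subproof g f).

End Composition.
Arguments bop_id {R V}.

Definition dual {R : realType} (V : normedModType R) : normedModType R :=
  bop V R^o.

Definition adjoint {R : realType} {V W : normedModType R} (u : bop V W)
  (nu : dual W) : dual V := bop_comp nu u.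

(* Derivative at [s] of a curve defined on the interval [I]: it is one-sided
   at the end points of [I] (and no condition if [I] is a single point). *)
Definition has_derivative_within {R : realType} {V : normedModType R}
    (I : set R) (g : R -> V) (s : R) (l : V) : Prop :=
  (x - s)^-1 *: (g x - g s) @[x --> within I s^'] --> l.

(* In the rest of the file, the subspace [D] of [B], with its own norm, is
   represented by an injective bounded operator [j : D -> B]; then
   [adjoint j : dual B -> dual D] restricts functionals to [D], so that
   [`|adjoint j nu|] is the norm of [nu] in the dual of [D]. *)
Section Curves.
Context {R : realType} {B D : normedModType R}.
Variables (j : bop D B) (M : set (dual B)) (T : R) (mu : dual B).

(* The set C_mu([0,T], M(D^* )). Curves on [0,T] are encoded as functions on the
   whole line, unconstrained outside of [0,T]; [curve_dist] ignores the values
   taken there. *)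
Definition curves : set (R -> dual B) := [set xi |
  [/\ forall t, 0 <= t <= T -> M (xi t),
      {within `[0, T], continuous (fun t => adjoint j (xi t))} &
      xi 0 = mu]].

Definition curve_dist (xi eta : R -> dual B) : \bar R :=
  ereal_sup [set (`|adjoint j (xi t - eta t)|)%:E | t in `[0, T]].

End Curves.

Section Propagators.
Context {R : realType} {B D : normedModType R}.
Variables (j : bop D B) (T : R).

(* [U t r] is only meaningful for 0 <= t <= r <= T. *)
Definition backward_propagator (U : R -> R -> bop B B) : Prop :=
  (forall t, 0 <= t <= T -> U t t = bop_id) /\
  (forall t s r, 0 <= t -> t <= s -> s <= r -> r <= T ->
    bop_comp (U t s) (U s r) = U t r).

Definition strongly_continuous (U : R -> R -> bop B B) : Prop :=
  forall f : B,
    {within [set p : R * R | 0 <= p.1 <= p.2 /\ p.2 <= T],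
      continuous (fun p => U p.1 p.2 f)}.

(* [UD] is the restriction to [D] of the operators [U t r]; its existence says
   that they leave [D] invariant and are bounded there for the norm of [D]. *)
Definition restricts_to (U : R -> R -> bop B B) (UD : R -> R -> bop D D) :
    Prop :=
  forall t r, 0 <= t -> t <= r -> r <= T ->
    forall f : D, U t r (j f) = j (UD t r f).

Definition generates (L : R -> bop D B) (U : R -> R -> bop B B)
    (UD : R -> R -> bop D D) : Prop :=
  [/\ restricts_to U UD,
      forall f : D, {within `[0, T], continuous (fun t => L t f)},
      forall (f : D) t s, 0 <= t -> t <= s -> s <= T ->
        has_derivative_within `[t, T] (fun x => U t x (j f)) s
          (U t s (L s f)) &
      forall (f : D) s r, 0 <= s -> s <= r -> r <= T ->
        has_derivative_within `[0, r] (fun x => U x r (j f)) s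
          (- L s (UD s r f))].

End Propagators.

(* Main.v *)
(* A solution is a fixed point of the map [Phi] sending a curve [xi] to
   [t |-> (U xi 0 t)^* mu]. By Duhamel's formula [Phi] is Lipschitz for the
   uniform distance in the dual of [D], and its values are uniformly Lipschitz
   curves, so that hypothesis (iii) makes its range totally bounded. Schauder's
   theorem is obtained directly from a combinatorial lemma of Scarf: given a
   finite eps-net [eta_f] of the range, colour each point [x] of a fine grid on
   the simplex by an index [f] such that [Phi (\sum_f x_f eta_f)] is eps-close
   to [eta_f]. Scarf's lemma yields a cluster of grid points that are nearly
   supported by the set of their own colours, and each of them gives an
   approximate fixed point. These converge along an ultrafilter. *)
Require Import Defs.
From HB Require Import structures.
From mathcomp Require Import all_boot all_order all_algebra.
From mathcomp Require Import all_classical all_reals all_analysis.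
From mathcomp Require Import zify ring lra.

Set Implicit Arguments.
Unset Strict Implicit.
Unset Printing Implicit Defensive.

Import Order.TTheory GRing.Theory Num.Theory.
Import numFieldNormedType.Exports.

(** * Scarf's lemma *)

Section Scarf.
(* [classical_sets] shadows many of the names of [finset]. *)
Import mathcomp.boot.fintype mathcomp.boot.finset.

(** One fibre of [f] on [A] has two points and all the others have one. A point can be removed
    without shrinking the image exactly when it lies in the double fibre. *)
Lemma card_redundant (T U : finType) (f : T -> U) (A : {set T}) :
  #|A| = #|f @: A|.+1 -> #|[set x in A | f @: (A :\ x) == f @: A]| = 2.
Proof.
move=> cA.
have /dinjectivePn[x xA [y /andP[/= yx yA] fxy]] : ~~ dinjectiveb f (mem A).
  apply/dinjectiveP => /card_in_imset fA; move: cA; rewrite fA => /eqP.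
  by rewrite -[X in X == _]addn0 -addn1 eqn_add2l.
have xy : x != y by rewrite eq_sym.
have fAx : f @: (A :\ x) = f @: A.
  apply/eqP; rewrite eqEsubset imsetS ?subsetDl//=.
  apply/subsetP => _ /imsetP[z zA ->]; have [->|zx] := eqVneq z x.
    by rewrite fxy imset_f// !inE yx.
  by rewrite imset_f// !inE zx.
have inj : {in A :\ x &, injective f}.
  by apply/imset_injP; rewrite fAx -eqSS -cA (cardsD1 x A) xA.
have -> : [set z in A | f @: (A :\ z) == f @: A] = [set x; y].
  apply/setP => z; rewrite !inE; have [->|zx] /= := eqVneq z x.
    by rewrite xA fAx eqxx.
  have [->|zy] /= := eqVneq z y.
    rewrite yA /= eqEsubset imsetS ?subsetDl//=.
    apply/subsetP => _ /imsetP[t tA ->]; have [->|ty] := eqVneq t y.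
      by rewrite -fxy imset_f// !inE xy.
    by rewrite imset_f// !inE ty.
  apply/negbTE/negP => /andP[zA /eqP fAz].
  have : f z \in f @: (A :\ z) by rewrite fAz imset_f.
  case/imsetP => t; rewrite !inE => /andP[tz tA] fzt.
  have [tx|tx] := eqVneq t x.
    by move/negP: zy; apply; apply/eqP/inj; rewrite ?inE ?zx ?yx// fzt tx.
  by move/negP: tz; apply; apply/eqP/inj; rewrite ?inE ?tx ?zx.
by rewrite cards2 xy.
Qed.

(** * Dominant sets for a family of linear orders *)

Section Dominance.
Variables (I Y : finType) (h : I -> Y -> nat).
Hypothesis h_inj : forall i, injective (h i).

(** Geometrically, for nonempty [P]: the simplex cut out by the minima of the [h i] over [P] has no
    point of [Y] in its interior. *)
Definition dominant (P : {set Y}) :=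
  [forall y, [exists i, [forall p in P, h i y <= h i p]]].

Lemma dominantP (P : {set Y}) :
  reflect (forall y, exists i, forall p, p \in P -> h i y <= h i p) (dominant P).
Proof.
apply: (iffP forallP) => [dP y|dP y].
  by have /existsP[i /forall_inP] := dP y; exists i.
by have [i ?] := dP y; apply/existsP; exists i; apply/forall_inP.
Qed.

Lemma dominantS (P Q : {set Y}) : Q \subset P -> dominant P -> dominant Q.
Proof.
move=> /subsetP QP /dominantP dP; apply/dominantP => y.
by have [i iP] := dP y; exists i => p /QP /iP.
Qed.

Definition amin (y0 : Y) (P : {set Y}) i := [arg min_(y < y0 in P) h i y].

Lemma aminP y0 (P : {set Y}) i : y0 \in P ->
  amin y0 P i \in P /\ forall p, p \in P -> h i (amin y0 P i) <= h i p.
Proof. by move=> y0P; rewrite /amin; case: arg_minnP. Qed.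

Lemma amin_eq y0 (P : {set Y}) i y : y \in P ->
  (forall p, p \in P -> h i y <= h i p) -> y0 \in P -> amin y0 P i = y.
Proof.
move=> yP yle y0P; have [aP ale] := aminP i y0P.
by apply: (@h_inj i); apply/eqP; rewrite eqn_leq ale// yle.
Qed.

Lemma amin_imset y0 (P : {set Y}) : y0 \in P -> dominant P ->
  amin y0 P @: [set: I] = P.
Proof.
move=> y0P /dominantP dP; apply/setP => y; apply/imsetP/idP.
  by move=> [i _ ->]; have [] := aminP i y0P.
by move=> yP; have [i ile] := dP y; exists i => //; rewrite (amin_eq yP).
Qed.

Definition redundant (Q : {set Y}) := [set k |
  [forall q in Q, [exists l, (l != k) && [forall p in Q, h l q <= h l p]]]].

(** The interior of the simplex of [Q] once its face [k] is dropped. A point that completes [Q] by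
    taking over the index [k] has to be found there. *)
Definition above (Q : {set Y}) k :=
  [set z | [forall (l | l != k), [exists p in Q, h l p < h l z]]].

Lemma redundantP (Q : {set Y}) k : reflect
  (forall q, q \in Q -> exists2 l, l != k & forall p, p \in Q -> h l q <= h l p)
  (k \in redundant Q).
Proof.
rewrite inE; apply: (iffP forall_inP) => kQ q /kQ.
  by case/existsP => l /andP[lk /forall_inP]; exists l.
by case=> l lk lQ; apply/existsP; exists l; rewrite lk; apply/forall_inP.
Qed.

Lemma aboveP (Q : {set Y}) k z : reflect
  (forall l, l != k -> exists2 p, p \in Q & h l p < h l z) (z \in above Q k).
Proof.
rewrite inE; apply: (iffP forall_inP) => kz l lk; first exact/exists_inP/kz.
exact/exists_inP/kz.
Qed.

Lemma dominant_not_above (Q : {set Y}) k z : dominant Q -> z \in above Q k ->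
  forall q, q \in Q -> h k z <= h k q.
Proof.
move=> /dominantP/(_ z)[i iz] /aboveP zk; have [<-//|/zk[p pQ]] := eqVneq i k.
by rewrite ltnNge iz.
Qed.

Lemma above_inj (Q : {set Y}) k k' z : dominant Q ->
  z \in above Q k -> z \in above Q k' -> k = k'.
Proof.
move=> dQ zk zk'; apply/eqP/negPn/negP => kk'.
have /aboveP/(_ k kk')[p pQ] := zk'.
by rewrite ltnNge (dominant_not_above dQ zk).
Qed.

(* The points of a dominant set of size [#|I|] are in bijection with [I], each
   being minimal for its own order, so the added point takes over one of the
   redundant indices of [Q] and has to be as high as possible for it. *)
Lemma dominant_setU1 (Q : {set Y}) y : #|I| = #|Q|.+1 -> dominant Q ->
  (y \notin Q) && dominant (y |: Q) <->
  exists k, [/\ k \in redundant Q, y \in above Q k &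
               forall z, z \in above Q k -> h k z <= h k y].
Proof.
move=> cQ dQ; split.
  move=> /andP[yQ dP]; set P := y |: Q in dP.
  have yP : y \in P by rewrite !inE eqxx.
  have aP := amin_imset yP dP.
  have a_inj : injective (amin y P).
    move=> i l; apply: (@imset_injP _ _ (amin y P) (mem [set: I])) => //.
    by rewrite -[_ @: _]/(amin y P @: [set: I]) aP cardsT cQ /P cardsU1 yQ.
  have : y \in amin y P @: [set: I] by rewrite aP.
  case/imsetP => k _ yk; exists k; split.
  - apply/redundantP => q qQ.
    have : q \in amin y P @: [set: I] by rewrite aP !inE qQ orbT.
    case/imsetP => l _ ql; exists l.
      by apply/eqP => lk; move: yQ; rewrite yk -lk -ql qQ.
    by move=> p pQ; rewrite ql; apply: (aminP _ yP).2; rewrite !inE pQ orbT.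
  - apply/aboveP => l lk; have [] := aminP l yP.
    have aly : amin y P l != y.
      by apply/eqP; rewrite [X in _ = X]yk => /a_inj /eqP; rewrite (negbTE lk).
    rewrite {1}/P in_setU1 (negbTE aly) /= => alQ /(_ y yP) aly'.
    exists (amin y P l) => //; rewrite ltn_neqAle aly' andbT.
    by apply: contra aly => /eqP /h_inj ->.
  - move=> z /aboveP zk; have /dominantP/(_ z)[i iz] := dP.
    have [<-|/zk[p pQ]] := eqVneq i k; first exact: iz.
    by rewrite ltnNge iz// !inE pQ orbT.
move=> [k [/redundantP kQ yk ymax]]; apply/andP; split.
  apply/negP => yQ; have [l lk yl] := kQ y yQ.
  by move/aboveP : yk => /(_ l lk)[p pQ]; rewrite ltnNge yl.
apply/dominantP => z; have [zk|] := boolP (z \in above Q k).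
  exists k => p; rewrite !inE => /orP[/eqP ->|]; first exact: ymax.
  exact: dominant_not_above zk _.
rewrite inE => /forall_inPn[l lk /exists_inPn lz]; exists l => p.
have zle q : q \in Q -> h l z <= h l q by move=> qQ; rewrite leqNgt lz.
rewrite !inE => /orP[/eqP ->|]; last exact: zle.
move/aboveP : yk => /(_ l lk)[q qQ] /ltnW; exact: leq_trans (zle q qQ).
Qed.

(** By [dominant_setU1], the completions of [Q] are the highest points, for [h k], of the nonempty
    sets [above Q k] with [k] redundant. There is one for each [k], and [above_inj] keeps those of
    different indices apart. *)
Lemma card_dominant_setU1 (Q : {set Y}) : #|I| = #|Q|.+1 -> dominant Q ->
  #|[set y | (y \notin Q) && dominant (y |: Q)]| =
  #|[set k in redundant Q | above Q k != set0]|.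
Proof.
move=> cQ dQ; set E := [set k in _ | _].
have [/eqP E0|[k0]] := set_0Vmem E.
  rewrite (eqP E0) cards0; apply/eqP; rewrite cards_eq0 -subset0.
  apply/subsetP => y; rewrite inE => /(dominant_setU1 _ cQ dQ)[k [kQ yk _]].
  have : k \in E by rewrite inE kQ; apply/set0Pn; exists y.
  by rewrite (eqP E0) inE.
rewrite inE => /andP[_ /set0Pn[y0 _]].
pose top k := [arg max_(y > odflt y0 [pick y in above Q k] in above Q k) h k y].
have topP k : k \in E ->
    top k \in above Q k /\ forall z, z \in above Q k -> h k z <= h k (top k).
  rewrite inE => /andP[_ /set0Pn[y yk]]; rewrite /top.
  case: pickP => [y' y'k|/(_ y)] /=; last by rewrite yk.
  by case: arg_maxnP.
rewrite -(@card_in_imset _ _ top).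
  apply: eq_card => y; rewrite inE; apply/idP/imsetP.
    move=> /(dominant_setU1 _ cQ dQ)[k [kQ yk ymax]].
    have kE : k \in E by rewrite inE kQ; apply/set0Pn; exists y.
    exists k => //; have [tk tmax] := topP k kE.
    by apply: (@h_inj k); apply/eqP; rewrite eqn_leq tmax// ymax.
  move=> [k kE ->]; have [tk tmax] := topP k kE.
  by apply/(dominant_setU1 _ cQ dQ); exists k; split=> //; move: kE; rewrite inE => /andP[].
move=> k k' /topP[tk _] /topP[tk' _] kk'; apply: (above_inj dQ tk).
by rewrite kk'.
Qed.

(** [amin y0 Q] maps [I] onto [Q], which has one element less, so two indices share their minimum
    and [card_redundant] applies. *)
Lemma card_redundant_dominant (Q : {set Y}) : Q != set0 -> #|I| = #|Q|.+1 ->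
  dominant Q -> #|redundant Q| = 2.
Proof.
move=> /set0Pn[y0 y0Q] cQ dQ; have aQ := amin_imset y0Q dQ.
have := @card_redundant _ _ (amin y0 Q) [set: I].
rewrite aQ cardsT => /(_ cQ) <-; apply: eq_card => k; rewrite in_set in_setT /=.
apply/redundantP/eqP => [kQ|Qk q].
  apply/eqP; rewrite eqEsubset; apply/andP; split.
    by have := imsetS (amin y0 Q) (subsetT ([set: I] :\ k)); rewrite aQ.
  apply/subsetP => q qQ; have [l lk ql] := kQ q qQ.
  by apply/imsetP; exists l; rewrite ?inE ?lk// (amin_eq qQ).
rewrite -{1}Qk => /imsetP[l]; rewrite !inE andbT => lk ->.
by exists l => // p; apply: (aminP l y0Q).2.
Qed.

End Dominance.

(* The slack points [s i] stand for the faces of the simplex: they avoid a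
   separate treatment of the dominant sets that lie on the boundary. *)
Section Slack.
Variables (I Y : finType) (h : I -> Y -> nat) (s : I -> Y) (c : Y -> I).
Hypothesis h_inj : forall i, injective (h i).
Hypothesis h_slack : forall i y, h i (s i) <= h i y.
Hypothesis h_slack_top :
  forall i j y, y \notin codom s -> j != i -> h i y < h i (s j).
Hypothesis c_slack : cancel s c.
Variable x0 : Y.
Hypothesis x0s : x0 \notin codom s.

Let s_inj : injective s := can_inj c_slack.

Lemma h_slack_lt i y : y != s i -> h i (s i) < h i y.
Proof.
by move=> ysi; rewrite ltn_neqAle h_slack andbT; apply: contra ysi => /eqP /h_inj ->.
Qed.

Lemma dominant_slack i0 : dominant h (s @: [set~ i0]).
Proof.
apply/dominantP => y; have [/codomP[j ->]|ys] := boolP (y \in codom s).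
  by exists j => p _; exact: h_slack.
exists i0 => _ /imsetP[j + ->]; rewrite !inE => j0.
exact/ltnW/h_slack_top.
Qed.

(** This facet can be completed through [i0] only. For another redundant [k], [s k] must be the
    minimum of the facet for [h i0]. Then a genuine point is too low for [h i0], so is [s k], and
    any other slack point is too low for its own order. *)
Lemma slack_redundant_above i0 :
  [set k in redundant h (s @: [set~ i0]) | above h (s @: [set~ i0]) k != set0]
  = [set i0].
Proof.
have sP j : j != i0 -> s j \in s @: [set~ i0] by move=> j0; rewrite imset_f ?inE.
apply/setP => k; rewrite in_set in_set1; have [->|ki0] := eqVneq k i0.
  apply/andP; split.
    apply/redundantP => _ /imsetP[j + ->]; rewrite !inE => j0.
    by exists j => // p _; exact: h_slack.
  apply/set0Pn; exists x0; apply/aboveP => l l0; exists (s l); first exact: sP.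
  by apply: h_slack_lt; apply: contra x0s => /eqP ->; exact: codom_f.
apply/negbTE/negP => /andP[/redundantP kQ /set0Pn[z /aboveP zk]].
have [l lk lmin] := kQ _ (sP _ ki0).
have li0 : l = i0.
  apply/eqP/negPn/negP => /sP /lmin; rewrite leqNgt h_slack_lt//.
  by apply: contra lk => /eqP /s_inj ->.
have [/codomP[j zj]|zs] := boolP (z \in codom s).
  have [jk|/zk[p pQ]] := eqVneq j k; last by rewrite zj ltnNge h_slack.
  have [p pQ] := zk l lk; rewrite zj jk ltnNge => /negP; apply; exact: lmin.
have [_ /imsetP[j + ->]] := zk l lk; rewrite !inE => j0.
by rewrite li0 ltnNge ltnW// h_slack_top.
Qed.

(** If [Q] has a genuine point [x], then [x] lies under [s k] in every order but [k], so [s k]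
    belongs to [above Q k] and both redundant indices give a completion. Otherwise [Q] is the slack
    facet, with one completion. *)
Lemma odd_dominant_setU1 i0 (Q : {set Y}) :
  dominant h Q -> #|I| = #|Q|.+1 -> c @: Q = [set~ i0] ->
  odd #|[set y | (y \notin Q) && dominant h (y |: Q)]| = (Q == s @: [set~ i0]).
Proof.
move=> dQ cQ colQ; rewrite card_dominant_setU1//.
have [->|Qs] := eqVneq Q _; first by rewrite slack_redundant_above cards1.
have [x xQ xs] : exists2 x, x \in Q & x \notin codom s.
  apply/exists_inP; apply: contraR Qs => /exists_inPn Qs.
  have Qsub : Q \subset s @: [set~ i0].
    apply/subsetP => y yQ; have /negPn/codomP[j yj] := Qs y yQ.
    by rewrite yj imset_f// -colQ -(c_slack j) -yj imset_f.
  by rewrite eqEcard Qsub card_imset// cardsC1 cQ /=.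
have -> : [set k in redundant h Q | above h Q k != set0] = redundant h Q.
  apply/setP => k; rewrite inE andb_idr// => _; apply/set0Pn; exists (s k).
  by apply/aboveP => l lk; exists x => //; apply: h_slack_top; rewrite // eq_sym.
by rewrite card_redundant_dominant//; apply/set0Pn; exists x.
Qed.

(* Sperner's double counting of the pairs (door, room), where a room is a
   dominant set of [#|I|] points and a door is a room minus one point that
   bears all the colours but [i0]. *)
Lemma colourful_dominant (i0 : I) :
  exists P : {set Y}, [/\ dominant h P, #|P| = #|I| & c @: P = [set: I]].
Proof.
have [/exists_inP[P dP /andP[/eqP cP /eqP colP]]|] :=
  boolP [exists P in dominant h, (#|P| == #|I|) && (c @: P == [set: I])].
  by exists P.
move=> /exists_inPn noP; exfalso.
have n0 : 0 < #|I| by apply/card_gt0P; exists i0.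
pose door (Q : {set Y}) := [&& dominant h Q, #|I| == #|Q|.+1 & c @: Q == [set~ i0]].
pose room (P : {set Y}) := dominant h P && (#|P| == #|I|).
have count : \sum_(Q | door Q) #|[set y | (y \notin Q) && dominant h (y |: Q)]| =
             \sum_(P | room P) #|[set y in P | c @: (P :\ y) == [set~ i0]]|.
  under eq_bigr => Q _ do rewrite -sum1dep_card.
  under [RHS]eq_bigr => P _ do rewrite -sum1dep_card.
  rewrite !pair_big_dep /=.
  rewrite [RHS](reindex_onto (fun p : {set Y} * Y => (p.2 |: p.1, p.2))
                        (fun p => (p.1 :\ p.2, p.2))) /=; last first.
    by case=> P y /= /andP[_ /andP[yP _]]; rewrite setD1K.
  apply: eq_bigl => -[Q y] /=; rewrite xpair_eqE eqxx andbT.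
  have [yQ|yQ] /= := boolP (y \in Q).
    rewrite andbF; apply/esym/negbTE/negP => /andP[_ /eqP /setP /(_ y)].
    by rewrite !inE eqxx yQ.
  rewrite setU1K// eqxx andbT /door /room setU11 /= cardsU1 yQ add1n.
  rewrite [#|I| == _]eq_sym.
  have [dP|_] := boolP (dominant h (y |: Q)); last by rewrite andbF.
  by rewrite (dominantS (subsetUr _ _) dP) andbT.
(* A room that misses a colour has either no door or the two doors given by [card_redundant]. *)
have : odd (\sum_(P | room P) #|[set y in P | c @: (P :\ y) == [set~ i0]]|) = false.
  apply: (big_ind (fun n => odd n = false)) => // [m n m0 n0'|P /andP[dP /eqP cP]].
    by rewrite oddD m0 n0'.
  set E := [set y in P | _]; have [->|[y]] := set_0Vmem E; first by rewrite cards0.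
  rewrite inE => /andP[yP /eqP colPy].
  have colP : c @: P = [set~ i0].
    apply/eqP; rewrite eq_sym eqEcard -colPy imsetS ?subsetDl//= colPy cardsC1.
    rewrite -ltnS prednK// ltn_neqAle -[X in _ <= X]cP leq_imset_card andbT.
    apply: contra (noP P dP) => cP'; rewrite cP eqxx /=.
    by rewrite eqEcard subsetT cardsT (eqP cP') /=.
  by rewrite /E -colP card_redundant// colP cardsC1 cP prednK.
(* The slack facet is the only door with an odd number of completions, which contradicts the even
   count over the rooms. *)
rewrite -count (bigD1 (s @: [set~ i0])) /=; last first.
  rewrite /door dominant_slack card_imset// cardsC1 prednK// eqxx /=.
  by rewrite -imset_comp (eq_imset _ c_slack) imset_id.
rewrite oddD (@odd_dominant_setU1 i0) ?dominant_slack//; last 2 first.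
- by rewrite card_imset// cardsC1 prednK.
- by rewrite -imset_comp (eq_imset _ c_slack) imset_id.
rewrite eqxx /= (_ : odd _ = false)//.
apply: (big_ind (fun n => odd n = false)) => // [m n m0 n0'|Q].
  by rewrite oddD m0 n0'.
move=> /andP[/and3P[dQ /eqP cQ /eqP colQ] Qs].
by rewrite (@odd_dominant_setU1 i0)// (negbTE Qs).
Qed.

End Slack.

(** Add to [X] one slack point per index, coloured by that index, and let [A] be the genuine part of
    a colourful dominant set. The index [i] that dominates [x] is the colour of a genuine point,
    since the slack point of [i] has rank 0 for [h' i] and would lie below [x]. *)
Lemma scarf (I X : finType) (h : I -> X -> nat) (c : X -> I) (x0 : X) :
  (forall i, injective (h i)) ->
  exists A : {set X}, forall x, exists2 i, i \in c @: A &
    forall a, a \in A -> h i x <= h i a.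
Proof.
move=> h_inj.
(* Genuine ranks are shifted by one to free 0 for the slack point of [i], hence the 2. Adding
   [enum_rank j] separates the other slack points. *)
pose big i := (\max_x h i x).+2.
pose h' i (y : X + I) := match y with
  | inl x => (h i x).+1
  | inr j => if j == i then 0 else big i + enum_rank j
  end.
have hbig i x : (h i x).+1 < big i by rewrite /big !ltnS (leq_bigmax x).
have h'_inj i : injective (h' i).
  move=> [x|j] [x'|j'] /=.
  - by move=> [/h_inj ->].
  - case: ifP => // _ hE; have := hbig i x.
    by rewrite hE ltnNge leq_addr.
  - case: ifP => // _ hE; have := hbig i x'.
    by rewrite -hE ltnNge leq_addr.
  - have [->|ji] := eqVneq j i; have [->|ji'] := eqVneq j' i => //.
    by move/eqP; rewrite eqn_add2l => /eqP /val_inj /enum_rank_inj ->.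
pose c' (y : X + I) := match y with inl x => c x | inr j => j end.
have [i|i j y|//||P [/dominantP dP cP colP]] :=
  @colourful_dominant I _ h' inr c' h'_inj _ _ _ (inl x0) _ (c x0).
- by move=> y /=; rewrite eqxx.
- case: y => [x _ /= /negbTE ->|j' /negP[]]; last exact: codom_f.
  exact: leq_trans (hbig i x) (leq_addr _ _).
- by apply/codomP => -[].
have c_inj : {in P &, injective c'}.
  by apply/imset_injP; rewrite colP cardsT cP.
exists [set x | inl x \in P] => x; have [i iP] := dP (inl x).
exists i; last by move=> a; rewrite inE => /iP.
have : i \in c' @: P by rewrite colP.
case/imsetP => -[y yP ->|j jP ij]; first by rewrite /= imset_f ?inE.
by have := iP _ jP; rewrite /= ij /= eqxx.
Qed.

(* The points of the grid of mesh [1 / N] on the simplex are numbered so as to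
   break the ties between their barycentric coordinates; a set that is
   dominant for the coordinates in [C] lies in a simplex of size
   [O(#|C| / N)] next to the face spanned by [C]. *)
Lemma simplex_colouring (I : finType) (i0 : I) (N : nat)
    (c : {ffun I -> 'I_N.+1} -> I) :
  exists (x : {ffun I -> 'I_N.+1}) (C : {set I}),
    [/\ \sum_i x i = N, \sum_(i | i \notin C) x i <= #|I| &
        forall i, i \in C -> exists b : {ffun I -> 'I_N.+1},
          [/\ \sum_i b i = N, c b = i &
              \sum_i ((x i - b i) + (b i - x i)) <= 2 * #|I|]].
Proof.
pose X : finType := {x : {ffun I -> 'I_N.+1} | \sum_i x i == N}.
have mk (f : I -> nat) : \sum_i f i = N ->
    {x : X | forall i, val x i = f i :> nat}.
  move=> fN; have fle i : f i < N.+1 by rewrite ltnS -fN (bigD1 i)//= leq_addr.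
  have xN : \sum_i [ffun i => Ordinal (fle i)] i == N.
    by rewrite -[X in _ == X]fN; apply/eqP/eq_bigr => i _; rewrite ffunE.
  by exists (exist _ [ffun i => Ordinal (fle i)] xN) => i /=; rewrite ffunE.
pose h i (x : X) := val x i * #|X| + enum_rank x.
have hle i x y : h i x <= h i y -> val x i <= val y i.
  rewrite /h; have := ltn_ord (enum_rank y).
  move=> ry; apply: contraTT; rewrite -!ltnNge => xy.
  have : (val y i).+1 * #|X| <= val x i * #|X| by rewrite leq_mul2r xy orbT.
  rewrite mulSn => xyX; apply: leq_trans (leq_addr _ _).
  by apply: leq_trans xyX; rewrite addnC -addSn leq_add2r.
have h_inj i : injective (h i).
  move=> x y hxy; apply/enum_rank_inj/val_inj/eqP.
  have xy : val x i = val y i :> nat.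
    by apply/eqP; rewrite eqn_leq !hle// hxy.
  by move: hxy; rewrite /h xy => /eqP; rewrite eqn_add2l.
have [|x0 _] := mk (fun i => if i == i0 then N else 0).
  by rewrite -big_mkcond big_pred1_eq.
have [A domA] := scarf (c \o val) x0 h_inj.
set C := (c \o val) @: A in domA.
have [a0 a0A] : exists a, a \in A.
  by have [i /imsetP[a aA _] _] := domA x0; exists a.
(* [m] is the corner under the cluster: minima over [A] in the directions of [C], and 0
   elsewhere. *)
pose m i := if i \in C then val [arg min_(a < a0 in A) val a i : nat] i : nat else 0.
have m_le a i : a \in A -> m i <= val a i.
  by move=> aA; rewrite /m; case: ifP => // _; case: arg_minnP => // b _; apply.
(* Otherwise, raising every [m i] with [i] in [C] by one and putting the mass left over on [i1]
   gives a grid point that no index of [C] dominates. *)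
have m_big : N < \sum_(i in C) (m i).+1.
  rewrite ltnNge; apply/negP => mN.
  have [i1 i1C _] := domA x0.
  pose f i := (if i \in C then (m i).+1 else 0) +
    (if i == i1 then N - \sum_(i in C) (m i).+1 else 0).
  have [|x xf] := mk f.
    rewrite /f big_split /= -big_mkcond -[in X in _ + X]big_mkcond /=.
    by rewrite big_pred1_eq subnKC.
  have [i iC iA] := domA x.
  have [a aA am] : exists2 a, a \in A & val a i = m i :> nat.
    rewrite /m iC; exists [arg min_(a < a0 in A) val a i : nat] => //.
    by case: arg_minnP.
  have := hle _ _ _ (iA a aA); rewrite xf am /f iC.
  by rewrite leqNgt ltnS leq_addr.
(* The coordinates of [a] add up to [N], which [m_big] bounds by the sum of [m] plus [#|I|]. *)
have sum_sub a : a \in A -> \sum_i (val a i - m i) <= #|I|.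
  move=> aA; rewrite -(leq_add2r (\sum_i m i)) -big_split /=.
  under eq_bigr => i _ do rewrite subnK ?m_le//.
  rewrite (eqP (valP a)) (leq_trans (ltnW m_big))//.
  under eq_bigr => i _ do rewrite -add1n.
  rewrite big_split /= sum1_card leq_add ?max_card//.
  by rewrite [leqRHS](bigID (mem C)) /= leq_addr.
exists (val a0), C; split.
- exact/eqP/(valP a0).
- apply: leq_trans (sum_sub a0 a0A); rewrite [leqRHS](bigID (mem C)) /=.
  rewrite (leq_trans _ (leq_addl _ _))//; apply: leq_sum => i iC.
  by rewrite /m (negbTE iC) subn0.
- move=> _ /imsetP[b bA ->]; exists (val b); split=> //; first exact/eqP/(valP b).
  rewrite mul2n -addnn (leq_trans _ (leq_add (sum_sub a0 a0A) (sum_sub b bA)))//.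
  rewrite -big_split /= leq_sum// => i _.
  have dist (k u v : nat) : k <= u -> k <= v -> u - v + (v - u) <= u - k + (v - k).
    by lia.
  by apply: dist; exact: m_le.
Qed.

End Scarf.

Local Open Scope classical_set_scope.
Local Open Scope ring_scope.

(** * Approximate fixed points *)

Section Schauder.
Context {R : realType} {V : lmodType R}.

Lemma convex_combination (K : set V) (F : finType) (w : F -> R) (y : F -> V) :
  (forall x z a, K x -> K z -> 0 <= a <= 1 -> K (a *: x + (1 - a) *: z)) ->
  (forall i, 0 <= w i) -> \sum_i w i = 1 -> (forall i, K (y i)) ->
  K (\sum_i w i *: y i).
Proof.
move=> Kconv w0 w1 Ky.
have [i0 _] : exists i0 : F, true.
  have [/existsP[i0 _]|/existsPn F0] := boolP [exists i : F, true].
    by exists i0.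
  move: w1; rewrite big1 => [/esym/eqP|i]; first by rewrite oner_eq0.
  by have := F0 i.
(* The induction runs over partial sums, whose weights do not add up to 1: each is its total weight
   times a point of [K], which is arbitrary when that weight is 0. *)
suff [z Kz] : exists2 z, K z &
    \sum_i w i *: y i = (\sum_i w i) *: z by rewrite w1 scale1r => ->.
elim: (index_enum F) => [|i s [z Kz]]; rewrite ?big_nil ?big_cons.
  by exists (y i0); rewrite ?scale0r.
move=> ->; set W := \sum_(j <- s) w j.
have W0 : 0 <= W by exact: sumr_ge0.
have [iW|iW] := eqVneq (w i + W) 0.
  have [-> ->] : w i = 0 /\ W = 0 by have := w0 i; split; lra.
  by exists (y i); rewrite ?scale0r ?addr0 ?scale0r ?add0r.
have iW0 : 0 < w i + W by rewrite lt_def iW addr_ge0.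
exists ((w i / (w i + W)) *: y i + (1 - w i / (w i + W)) *: z).
  apply: Kconv => //; rewrite divr_ge0 ?(ltW iW0)//=.
  by rewrite ler_pdivrMr// mul1r lerDl.
rewrite scalerDr !scalerA; congr (_ *: _ + _ *: _); field.
  exact: iW.
exact: iW.
Qed.

(** This family of seminorms stands for a sup norm, which need not be finite on all of [V];
    estimates are required uniformly in the index instead. *)
Variables (J : Type) (q : J -> V -> R).
Hypothesis qD : forall t x y, q t (x + y) <= q t x + q t y.
Hypothesis qZ : forall t a x, q t (a *: x) = `|a| * q t x.

Lemma seminorm_sum t (F : finType) (a : F -> R) (x : F -> V) :
  q t (\sum_i a i *: x i) <= \sum_i `|a i| * q t (x i).
Proof.
elim: (index_enum F) => [|i s ih]; rewrite ?big_nil ?big_cons.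
  by rewrite -(scale0r 0) qZ normr0 mul0r.
by rewrite (le_trans (qD _ _ _))// qZ lerD2l.
Qed.

Lemma seminormN t x : q t (- x) = q t x.
Proof. by rewrite -scaleN1r qZ normrN normr1 mul1r. Qed.

Lemma seminorm_ge0 t x : 0 <= q t x.
Proof.
have := qD t x (- x); rewrite seminormN subrr -{1}(scale0r 0) qZ normr0 mul0r.
by lra.
Qed.

Variables (K : set V) (C : R) (Phi : V -> V) (L : R) (x0 : V).
Hypothesis Kconv :
  forall x y a, K x -> K y -> 0 <= a <= 1 -> K (a *: x + (1 - a) *: y).
Hypothesis C0 : 0 <= C.
Hypothesis KC : forall x, K x -> forall t, q t x <= C.
Hypothesis PhiK : forall x, K x -> K (Phi x).
Hypothesis L0 : 0 <= L.
Hypothesis PhiL : forall x y e, K x -> K y ->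
  (forall t, q t (x - y) <= e) -> forall t, q t (Phi x - Phi y) <= L * e.
Hypothesis Kx0 : K x0.

Lemma approximate_fixed_point (eps : R) (F : finType) (col : V -> F) :
  0 < eps ->
  (forall x y, K x -> K y -> col x = col y ->
    forall t, q t (Phi x - Phi y) <= eps) ->
  exists2 x, K x & forall t, q t (Phi x - x) <= 2 * eps.
Proof.
move=> eps0 colP; pose n := #|F|%:R : R.
have n0 : 0 <= n by exact: ler0n.
(* A point of [K] for each colour, with [x0] as default for colours not attained on [K]. *)
pose rep f := if pselect (exists x, K x /\ col x = f) is left e
  then projT1 (cid e) else x0.
have Krep f : K (rep f).
  by rewrite /rep; case: pselect => // e; case: cid => x [].
have repP x : K x -> col (rep (col x)) = col x.
  move=> Kx; rewrite /rep; case: pselect => [e|[]]; last by exists x.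
  by case: cid => y [].
pose eta f := Phi (rep f); have Keta f : K (eta f) by exact: PhiK.
(* The numerator collects the two errors of order [1 / N] below: [L] times the size of the cluster,
   and the weight carried by indices outside [A]. Together they stay under [eps]. *)
pose N := (Num.trunc ((L * (2 * n * C) + 2 * C * n) / eps)).+1.
have NR : (L * (2 * n * C) + 2 * C * n) / eps < N%:R by exact: truncnS_gt.
have N0 : 0 < N%:R :> R by rewrite ltr0n.
pose xi (x : {ffun F -> 'I_N.+1}) := \sum_i ((x i)%:R / N%:R) *: eta i.
have sum1 (x : {ffun F -> 'I_N.+1}) : (\sum_i x i = N)%N ->
    \sum_i ((x i)%:R / N%:R) = 1 :> R.
  by move=> xN; rewrite -mulr_suml -natr_sum xN divff// gt_eqF.
have Kxi (x : {ffun F -> 'I_N.+1}) : (\sum_i x i = N)%N -> K (xi x).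
  by move=> xN; apply: convex_combination => //; exact: sum1.
have [x [A [xN xA colA]]] :=
  simplex_colouring (col x0) (fun x : {ffun F -> 'I_N.+1} => col (xi x)).
exists (xi x); first exact: Kxi.
move=> t; set Px := Phi (xi x).
have -> : Px - xi x = \sum_i ((x i)%:R / N%:R) *: (Px - eta i).
  under eq_bigr => i _ do rewrite scalerBr.
  by rewrite sumrB -scaler_suml sum1// scale1r.
apply: le_trans (seminorm_sum _ _ _) _.
(* [eps] compares points of equal colour. The other term is the Lipschitz bound between [xi x] and
   [xi b], where [b] is the cluster point of colour [i]: the weights differ by at most [2 * n / N]
   in total. *)
pose e := eps + L * (2 * n * C / N%:R).
have inA i : i \in A -> q t (Px - eta i) <= e.
  move=> /colA[b [bN bi xb]].
  rewrite -(subrKA (Phi (xi b))) (le_trans (qD _ _ _))// addrC lerD//.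
    by apply: colP => //; [exact: Kxi|rewrite -bi repP//; exact: Kxi].
  apply: PhiL; [exact: Kxi|exact: Kxi|move=> {}t].
  have -> : xi x - xi b = \sum_i (((x i)%:R - (b i)%:R) / N%:R) *: eta i.
    by rewrite -sumrB; apply: eq_bigr => k _; rewrite mulrBl scalerBl.
  apply: le_trans (seminorm_sum _ _ _) _.
  have xbC k : `|((x k)%:R - (b k)%:R) / N%:R| * q t (eta k) <=
      ((x k - b k) + (b k - x k))%:R * (C / N%:R).
    rewrite normrM [`|_^-1|]ger0_norm ?invr_ge0 ?(ltW N0)// mulrAC mulrA.
    rewrite ler_pM2r ?invr_gt0// ler_pM//; last exact: KC.
      exact: seminorm_ge0.
    have [xk|xk] := leqP (x k) (b k).
      by rewrite distrC -natrB// ger0_norm// (eqP xk) add0n.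
    by rewrite -natrB 1?ltnW// ger0_norm// (eqP (ltnW xk)) addn0.
  apply: le_trans (ler_sum _ (fun k _ => xbC k)) _.
  rewrite -mulr_suml -natr_sum mulrA ler_pM2r ?invr_gt0// ler_wpM2r//.
  by rewrite /n -natrM ler_nat.
(* Outside [A] the crude bound [2 * C] suffices, as these indices have total weight at most
   [n / N]. *)
have bound i : `|(x i)%:R / N%:R| * q t (Px - eta i) <=
    (x i)%:R / N%:R * e + (if i \notin A then (x i)%:R else 0) * (2 * C / N%:R).
  have w0 : 0 <= (x i)%:R / N%:R :> R by rewrite divr_ge0.
  have e0 : 0 <= e by rewrite addr_ge0 ?(ltW eps0)// !mulr_ge0// invr_ge0.
  rewrite ger0_norm//.
  have [iA|iA] /= := boolP (i \in A).
    by rewrite mul0r addr0 ler_wpM2l// inA.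
  have -> : (x i)%:R * (2 * C / N%:R) = (x i)%:R / N%:R * (2 * C) by ring.
  rewrite -mulrDr ler_wpM2l// ler_wpDl// (le_trans (qD _ _ _))// seminormN.
  by have := KC (PhiK (Kxi x xN)) t; have := KC (Keta i) t; rewrite -/Px; lra.
apply: le_trans (ler_sum _ (fun i _ => bound i)) _.
rewrite big_split /= -mulr_suml sum1// mul1r -mulr_suml -big_mkcond /=.
rewrite -natr_sum.
apply: (@le_trans _ _ (e + n * (2 * C / N%:R))).
  by rewrite lerD2l ler_wpM2r ?ler_nat// !mulr_ge0// invr_ge0.
move: NR; rewrite ltr_pdivrMr// => NR.
have : (L * (2 * n * C) + 2 * C * n) / N%:R <= eps.
  by rewrite ler_pdivrMr// (mulrC eps) ltW.
have -> : (L * (2 * n * C) + 2 * C * n) / N%:R =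
    L * (2 * n * C / N%:R) + n * (2 * C / N%:R) by ring.
by rewrite /e; lra.
Qed.
End Schauder.

(** * Calculus *)

Section DerivativeWithin.
Context {R : realType}.
Implicit Types (I J : set R) (s : R).

Lemma has_derivative_withinS {V : normedModType R} I J (g : R -> V) s l :
  I `<=` J -> has_derivative_within J g s l -> has_derivative_within I g s l.
Proof.
by move=> IJ; apply: cvg_trans; apply: cvg_app; exact: within_subset.
Qed.

Lemma has_derivative_within_continuous {V : normedModType R} I (g : R -> V) s l :
  has_derivative_within I g s l -> g x @[x --> within I (nbhs s)] --> g s.
Proof.
move=> gl.
have : (x - s) *: ((x - s)^-1 *: (g x - g s)) @[x --> within I s^'] --> 0 *: l.
  apply: cvgZ gl; rewrite -[X in _ --> X](subrr s); apply: cvgB; last exact: cvg_cst.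
  by apply: cvg_within_filter; apply: cvg_within_filter; exact: cvg_id.
rewrite scale0r => /cvgrPdist_lt g0; apply/cvgrPdist_lt => e e0.
move: (g0 e e0); rewrite !near_withinE !near_simpl; apply: filterS => x xe Ix.
have [->|xs] := eqVneq x s; first by rewrite subrr normr0.
have := xe xs Ix; rewrite sub0r normrN scalerA mulfV ?subr_eq0// scale1r.
by rewrite distrC.
Qed.

Lemma has_derivative_within_linear {V W : normedModType R} (u : bop V W) I
    (g : R -> V) s l :
  has_derivative_within I g s l -> has_derivative_within I (u \o g) s (u l).
Proof.
move=> gl; rewrite /has_derivative_within /=.
under eq_fun => x do rewrite -linearB -linearZ.
by apply: continuous_cvg gl; exact: bop_continuous.
Qed.

(** A product rule under strong continuity of [P] only: the bound [C] absorbs [P x] applied to the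
    error of the difference quotient of [v], and elsewhere [P x] acts on the fixed vectors [v'] and
    [v s]. *)
Lemma has_derivative_within_apply {V W : normedModType R} I (P : R -> bop V W)
    (v : R -> V) s (v' : V) (w : W) (C : R) :
  (forall x, I x -> `|P x| <= C) ->
  (forall z, P x z @[x --> within I (nbhs s)] --> P s z) ->
  has_derivative_within I v s v' ->
  has_derivative_within I (fun x => P x (v s)) s w ->
  has_derivative_within I (fun x => P x (v x)) s (P s v' + w).
Proof.
move=> PC Pcont vv' Pw; rewrite /has_derivative_within.
have -> : (fun x => (x - s)^-1 *: (P x (v x) - P s (v s))) =
    (fun x => P x v' + P x ((x - s)^-1 *: (v x - v s) - v')
      + (x - s)^-1 *: (P x (v s) - P s (v s))).
  apply/funext => x; rewrite [P x (_ - v')]linearB addrCA subrr addr0.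
  by rewrite linearZ (linearB (P x)) -scalerDr /= subrKA.
apply: cvgD Pw; rewrite -[X in _ --> X]addr0; apply: cvgD.
  apply: cvg_trans (Pcont v'); apply: cvg_app => A; rewrite /= !nbhs_simpl.
  rewrite /within /=; apply: filterS => x + _; exact.
move/cvgrPdist_lt : vv' => vv'; apply/cvgrPdist_lt => e e0.
have C0 : 0 < `|C| + 1 by rewrite ltr_wpDl.
move: (vv' (e / (`|C| + 1)) (divr_gt0 e0 C0)).
rewrite !near_withinE !near_simpl; apply: filterS => x xe xs Ix.
rewrite sub0r normrN (le_lt_trans (opnormP _ _))//.
apply: (@le_lt_trans _ _ ((`|C| + 1) *  `|(x - s)^-1 *: (v x - v s) - v'|)).
  by rewrite ler_wpM2r// (le_trans (PC x Ix))// (le_trans (ler_norm _))// lerDl.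
by have := xe xs Ix; rewrite distrC ltr_pdivlMr// mulrC.
Qed.

Lemma has_derivative_within_itv (a b : R) (g : R -> R) s l :
  s \in `]a, b[ -> has_derivative_within `[a, b] (g : R -> R^o) s l ->
  is_derive s 1 g l.
Proof.
move=> sab gl; have sab' : nbhs s `[a, b]%classic.
  apply: filterS (near_in_itvoo sab) => x; exact: subset_itv_oo_cc.
suff : h^-1 *: ((g \o shift s) (h *: 1) - g s) @[h --> 0^'] --> l.
  move=> gl'; apply: DeriveDef; last exact/cvg_lim.
  by apply/cvg_ex; exists l.
apply/cvgrPdist_lt => e e0; move/cvgrPdist_lt : gl => /(_ e e0).
rewrite !near_withinE !near_simpl => gl.
have {}gl : \forall x \near s, x != s -> `|l - (x - s)^-1 *: (g x - g s)| < e.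
  by move: sab'; apply: filterS2 gl => x + xab xs; apply.
move: gl; rewrite (near_shift 0); apply: filterS => h /=.
rewrite subr0 [h *: 1]mulr1 => gl h0.
by have := gl; rewrite addrK; apply; rewrite -subr_eq0 addrK.
Qed.

Lemma mean_value_le (a b C : R) (g dg : R -> R) : a <= b ->
  (forall s, a <= s <= b -> has_derivative_within `[a, b] (g : R -> R^o) s (dg s)) ->
  (forall s, a <= s <= b -> `|dg s| <= C) ->
  `|g b - g a| <= C * (b - a).
Proof.
move=> ab gdg dgC.
have [||s] := @MVT_segment _ g dg a b ab.
- move=> s sab; apply: has_derivative_within_itv (sab) (gdg s _).
  by move: sab; rewrite in_itv /= => /andP[/ltW -> /ltW ->].
- apply/subspace_continuousP => s; rewrite /= in_itv /= => sab.
  exact: has_derivative_within_continuous (gdg s sab).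
- rewrite in_itv /= => sab ->; rewrite normrM [`|b - a|]ger0_norm ?subr_ge0//.
  by rewrite ler_wpM2r ?subr_ge0// dgC.
Qed.

End DerivativeWithin.

(** * Limits of bounded operators along a Cauchy filter *)

Section Completeness.
Context {R : realType} {V : normedModType R} {W : completeNormedModType R}.

Lemma bop_cvg (T : Type) (F : set_system T) (u : T -> bop V W) :
  ProperFilter F ->
  (forall e, 0 < e -> exists f : bop V W, \forall x \near F, `|f - u x| <= e) ->
  exists f : bop V W, u x @[x --> F] --> f.
Proof.
move=> FF Fc.
have ucvg v : exists l : W, u x v @[x --> F] --> l.
  suff uc : cvg (u x v @[x --> F]) by exists (lim (u x v @[x --> F])).
  apply: (@cauchy_cvg W _ (fmap_proper_filter _ FF)); apply/cauchy_exP => e e0.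
  have v0 : 0 < `|v| + 1 by rewrite ltr_wpDl.
  have [f fe] := Fc (e / (2 * (`|v| + 1))) (divr_gt0 e0 (mulr_gt0 (ltr0Sn _ _) v0)).
  exists (f v); apply: filterS fe => x fe; rewrite /= -ball_normE /=.
  apply: (@le_lt_trans _ _ (`|f - u x| * `|v|)).
    exact: (opnormP (f - u x)).
  apply: (@le_lt_trans _ _ (e / (2 * (`|v| + 1)) * (`|v| + 1))).
    by rewrite ler_pM// lerDl.
  rewrite invfM mulrA mulfVK ?gt_eqF//.
  by rewrite ltr_pdivrMr// mulr_natr mulr2n ltrDl.
pose l v := projT1 (cid (ucvg v)).
have ul v : u x v @[x --> F] --> l v by rewrite /l; case: cid.
have lP v y : u x v @[x --> F] --> y -> l v = y.
  by move=> vy; apply: (cvg_unique _ (ul v) vy).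
have lin : linear l.
  move=> k x y; apply: lP; under eq_fun => z do rewrite linearP.
  by apply: cvgD; [apply: cvgZr; exact: ul|exact: ul].
pose ll := HB.pack_for {linear V -> W} l (GRing.isLinear.Build R V W *:%R l lin).
(* Norm estimates along [F] survive the pointwise limit. With [e] equal to 1 this makes [l] bounded;
   with small [e] it gives convergence in operator norm. *)
have ldist (f : bop V W) e v : (\forall x \near F, `|f - u x| <= e) ->
    `|f v - l v| <= e * `|v|.
  move=> fe; apply: (@cvgr_to_le _ F _ _ (fun x => `|f v - u x v|)).
    by apply: cvg_norm; apply: cvgB; [exact: cvg_cst|exact: ul].
  apply: filterS fe => x fe; apply: le_trans (opnormP (f - u x) v) _.
  by rewrite ler_wpM2r.
have lP' : l \in bop_pred V W.
  apply/bop_predP; split=> //.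
  have [f fe] := Fc 1 ltr01.
  have lbd : bounded_near ll (nbhs 0).
    apply/bounded_funP => r; exists ((1 + `|f|) * r) => v vr.
    rewrite -(subrK (f v) (ll v)) (le_trans (ler_normD _ _))// distrC mulrDl.
    rewrite lerD ?(le_trans (ldist _ _ v fe))// ?mul1r//.
    by apply: le_trans (opnormP f v) _; apply: ler_wpM2l vr; exact: opnorm_ge0.
  by have /linear_bounded_continuous := lbd.
exists (Bop lP'); apply/cvgrPdist_le => e e0.
have [f fe] := Fc (e / 2) (divr_gt0 e0 (ltr0Sn _ _)).
apply: filterS (fe) => x fx.
rewrite -(subrKA f) -[Bop lP' - f]opprB (le_trans (ler_normD _ _))// normrN.
rewrite [leRHS]splitr lerD//; apply: opnorm_le; first by rewrite divr_ge0// ltW.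
by move=> v; exact: ldist.
Qed.

End Completeness.

Lemma has_derivative_within_eq {R : realType} {V : normedModType R} (I : set R)
    (g h : R -> V) s l :
  I s -> (forall x, I x -> g x = h x) ->
  has_derivative_within I h s l -> has_derivative_within I g s l.
Proof.
move=> Is gh; rewrite /has_derivative_within (gh s Is); apply: cvg_trans.
apply: near_eq_cvg; rewrite near_withinE; near=> x => Ix.
by rewrite gh.
Unshelve. all: by end_near. Qed.

(** * Compactness *)

Section FiniteColourings.
Context {R : realType}.

(** Cover the closure by finitely many balls of radius [e / 2] and colour a point by the first ball
    that contains it. *)
Lemma precompact_colouring {E : normedModType R} (X : set E) (e : R) : 0 < e ->
  precompact X -> exists (F : finType) (c : E -> F),
    forall x y, X x -> X y -> c x = c y -> `|x - y| <= e.
Proof.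
move=> e0; rewrite precompactE compact_cover => Xc.
have [|x _|G _ GX] := Xc _ setT (fun x => ball x (e / 2)).
- by move=> x _; exact: ball_open.
- by exists x => //; apply: ballxx; rewrite divr_gt0.
pose nearby (x i : E) := `[< ball i (e / 2) x >].
(* One colour more than balls, because [find] returns the size of the list for points outside all of
   them. *)
exists 'I_(size (finmap.enum_fset G)).+1,
  (fun x => inord (find (nearby x) (finmap.enum_fset G))) => x y Xx Xy.
move/(congr1 val); rewrite /= !inordK ?ltnS ?find_size// => xy.
have nearbyX z : X z ->
    ball (nth point (finmap.enum_fset G) (find (nearby z) (finmap.enum_fset G)))
      (e / 2) z.
  move=> /(@subset_closure _ X)/GX[i iG zi]; apply/asboolP.
  by apply: (@nth_find _ _ (nearby z)); apply/hasP; exists i => //; apply/asboolP.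
have := nearbyX y Xy; rewrite -xy; have := nearbyX x Xx.
move: (nth _ _ _) => i; rewrite -ball_normE /= => xi yi.
rewrite (le_trans (ler_distD i _ _))// [leRHS]splitr lerD// ltW//.
by rewrite distrC.
Qed.

Lemma colouring_seq {V : Type} {J : eqType} (K : set V) (r : J -> V -> V -> Prop)
    (l : seq J) :
  (forall t, t \in l -> exists (F : finType) (c : V -> F),
    forall x y, K x -> K y -> c x = c y -> r t x y) ->
  exists (F : finType) (c : V -> F),
    forall x y, K x -> K y -> c x = c y -> forall t, t \in l -> r t x y.
Proof.
elim: l => [_|t l ih tl]; first by exists unit, (fun=> tt).
have [u ul|F [c cP]] := ih; first by apply: tl; rewrite inE ul orbT.
have [G [d dP]] := tl t (mem_head _ _).
exists (F * G)%type, (fun x => (c x, d x)) => x y Kx Ky [cxy dxy] u.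
by rewrite inE => /predU1P[->|]; [exact: dP|exact: cP].
Qed.

Lemma dense_net (T d : R) (S : set R) : 0 < d -> `[0, T] `<=` closure S ->
  exists l : seq R, (forall s, s \in l -> S s) /\
    forall t, 0 <= t <= T -> exists2 s, s \in l & `|t - s| <= d.
Proof.
move=> d0 S_dense; have := @segment_compact R 0 T.
rewrite compact_cover => /(_ _ S (fun s => ball s d)) [s _|t /S_dense|G GS Gt].
- exact: ball_open.
- move=> /(_ _ (nbhsx_ballx t d d0))[s [Ss ts]]; exists s => //.
  exact: ball_sym.
- exists (finmap.enum_fset G); split=> [s sG|t t0T]; first by have := GS s sG; rewrite inE.
  have [|s /= sG] := Gt t; first by rewrite /= in_itv.
  by rewrite -ball_normE /= distrC => /ltW; exists s.
Qed.

(** Otherwise the ultrafilter contains the complement of every colour class, hence their finite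
    intersection, which is empty. This takes the place of extracting a subsequence. *)
Lemma ultra_colour {T : Type} (H : set_system T) (F : finType) (c : T -> F) :
  UltraFilter H -> exists f, \forall x \near H, c x = f.
Proof.
move=> UH; apply: contrapT => Hf.
have HC f : \forall x \near H, c x <> f.
  have [Hcf|//] := in_ultra_setVsetC [set x | c x = f] UH.
  by exfalso; apply: Hf; exists f.
have H_all : \forall x \near H, forall f, c x <> f by exact: filter_forall.
by have [x /(_ (c x))] := filter_ex H_all.
Qed.

End FiniteColourings.

(** * Restriction of functionals to [D] *)

Section Adjoint.
Context {R : realType} {B D : normedModType R}.
Variable j : bop D B.

Lemma adjointE {V W : normedModType R} (u : bop V W) (nu : dual W) f :
  adjoint u nu f = nu (u f).
Proof. by []. Qed.

Lemma adjointD nu nu' : adjoint j (nu + nu') = adjoint j nu + adjoint j nu'.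
Proof. exact/val_inj. Qed.

Lemma adjointZ a nu : adjoint j (a *: nu) = a *: adjoint j nu.
Proof. exact/val_inj. Qed.

Lemma adjointB nu nu' : adjoint j (nu - nu') = adjoint j nu - adjoint j nu'.
Proof. exact/val_inj. Qed.

Lemma adjoint_norm_le nu (j_norm : forall f : D, `|j f| <= `|f|) :
  `|adjoint j nu| <= `|nu|.
Proof.
apply: opnorm_le => // f; apply: le_trans (opnormP nu _) _.
by apply: ler_wpM2l; [exact: opnorm_ge0|exact: j_norm].
Qed.

(** Two distinct continuous functionals differ on a nonempty open set, which meets the range of
    [j]. *)
Lemma adjoint_inj (j_dense : dense (range j)) : injective (adjoint j).
Proof.
move=> nu nu' nunu'; apply/val_inj/funext => f /=.
apply: contrapT => fnu.
have nuf : nu f - nu' f != 0 by rewrite subr_eq0; exact/eqP.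
have [||g [/= gnu [h _ hg]]] := j_dense [set g | nu g - nu' g != 0].
- by exists f.
- apply: (@open_comp _ _ (fun g => nu g - nu' g : R^o) [set r | r != 0]).
    by move=> g _; apply: cvgB; exact: bop_continuous.
  exact: open_neq.
- move: gnu; rewrite -hg.
  have := congr1 (fun u : dual D => u h) nunu'; rewrite /= => ->.
  by rewrite subrr eqxx.
Qed.

End Adjoint.

(** * The solution map *)

Lemma ler_dist_chain {R : numDomainType} {V : normedZmodType R} (x y z : V) (a b : R) :
  `|x - y| <= a -> `|y - z| <= b -> `|x - z| <= a + b.
Proof. by move=> xy yz; rewrite (le_trans (ler_distD y _ _))// lerD. Qed.

Section SolutionMap.
Context {R : realType} {B D : completeNormedModType R}.
Variables (j : bop D B) (M : set (dual B)) (T : R) (mu : dual B).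
Variables (c1 c2 c3 : R).
Hypothesis j_norm : forall f : D, `|j f| <= `|f|.
Hypothesis M_mu : M mu.
Variable M0 : R.
Hypothesis M_bounded : forall nu, M nu -> `|nu| <= M0.
Hypothesis c1_gt0 : 0 < c1.
Hypothesis c2_gt0 : 0 < c2.
Hypothesis c3_gt0 : 0 < c3.
Hypothesis T_gt0 : 0 < T.

Lemma M0_ge0 : 0 <= M0.
Proof. exact: le_trans (M_bounded M_mu). Qed.

Lemma mu_le (z : B) : `|mu z| <= M0 * `|z|.
Proof.
apply: le_trans (opnormP mu z) _; apply: ler_wpM2r => //.
exact: M_bounded.
Qed.

Lemma bop_le {V W : normedModType R} (u : bop V W) (c : R) z :
  `|u| <= c -> `|u z| <= c * `|z|.
Proof. by move=> uc; apply: le_trans (opnormP u z) _; exact: ler_wpM2r. Qed.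

Lemma propagator_cvg (P : R -> R -> bop B B) z s : strongly_continuous T P ->
  0 <= s <= T -> P 0 x z @[x --> within `[0, T] (nbhs s)] --> P 0 s z.
Proof.
move=> /(_ z)/subspace_continuousP/(_ (0, s)) + /andP[s0 sT].
rewrite /= lexx s0 => /(_ (conj erefl sT)) Pz.
have pair : (0 : R, x) @[x --> s] --> (0 : R, s).
  by apply: (@cvg_pair R R R (nbhs s) (nbhs (0 : R)) (nbhs s)); [exact: cvg_cst|exact: cvg_id].
move=> X /Pz /pair; rewrite /= !nbhs_simpl /within /=.
apply: filterS => x; rewrite in_itv /= => H /andP[x0 xT].
by apply: H; rewrite lexx.
Qed.

(** Tested on [f], the curve has derivative [mu (P 0 x (L x f))], bounded by [M0 * c3 * c1] times
    the norm of [f] in [D]; the mean value inequality concludes. *)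
Lemma solution_lipschitz_time (L : R -> bop D B) P PD : generates j T L P PD ->
  (forall t, 0 <= t <= T -> `|L t| <= c1) ->
  (forall t s, 0 <= t -> t <= s -> s <= T -> `|P t s| <= c3) ->
  forall s t, 0 <= s <= T -> 0 <= t <= T ->
  `|adjoint j (adjoint (P 0 t) mu - adjoint (P 0 s) mu)| <= M0 * c3 * c1 * `|t - s|.
Proof.
move=> [_ _ Pr _] Lc Pc; suff H s t : 0 <= s -> s <= t -> t <= T ->
    `|adjoint j (adjoint (P 0 t) mu - adjoint (P 0 s) mu)|
      <= M0 * c3 * c1 * `|t - s|.
  move=> s t /andP[s0 sT] /andP[t0 tT]; have [st|/ltW ts] := leP s t; first exact: H.
  by rewrite adjointB distrC -adjointB distrC; exact: H.
move=> s0 st tT; apply: opnorm_le => [|f].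
  by rewrite !mulr_ge0 ?M0_ge0// ltW.
rewrite adjointE [`|t - s|]ger0_norm ?subr_ge0// mulrAC.
apply: (@mean_value_le _ s t _ (fun x => mu (P 0 x (j f)))
  (fun x => mu (P 0 x (L x f)))) => // x /andP[sx xt].
  apply: has_derivative_within_linear.
  have [x0 xT] := (le_trans s0 sx, le_trans xt tT).
  apply: has_derivative_withinS (Pr f 0 x _ x0 xT) => // y.
  by rewrite /= !in_itv /= => /andP[/(le_trans s0) -> /le_trans ->].
have [x0 xT] := (le_trans s0 sx, le_trans xt tT).
apply: le_trans (mu_le _) _; rewrite -!mulrA ler_wpM2l ?M0_ge0//.
apply: le_trans (bop_le _ (Pc 0 x _ x0 xT)) _ => //; rewrite ler_wpM2l ?(ltW c3_gt0)//.
by apply: bop_le; apply: Lc; rewrite x0.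
Qed.

(* Duhamel's formula in differential form: interpolate between the two
   solutions by [x |-> mu (P 0 x (Q x t f))]. *)
Lemma solution_lipschitz (LP LQ : R -> bop D B) P PD Q QD (e : R) :
  backward_propagator T P -> strongly_continuous T P -> generates j T LP P PD ->
  backward_propagator T Q -> generates j T LQ Q QD ->
  (forall t, 0 <= t <= T -> `|LP t - LQ t| <= e) ->
  (forall t s, 0 <= t -> t <= s -> s <= T -> `|P t s| <= c3) ->
  (forall t s, 0 <= t -> t <= s -> s <= T -> `|QD t s| <= c2) ->
  forall t, 0 <= t <= T ->
  `|adjoint j (adjoint (P 0 t) mu - adjoint (Q 0 t) mu)| <= M0 * c3 * c2 * T * e.
Proof.
move=> [P1 _] Pcont [_ _ Pr _] [Q1 _] [QQD _ _ Ql] LPQ Pc Qc t /andP[t0 tT].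
have T0 := ltW T_gt0; have e0 : 0 <= e.
  by apply: le_trans (LPQ 0 _) => //; rewrite lexx.
apply: opnorm_le => [|f]; first by rewrite !mulr_ge0 ?M0_ge0// ltW.
rewrite adjointE.
have -> : (adjoint (P 0 t) mu - adjoint (Q 0 t) mu) (j f) =
    mu (P 0 t (Q t t (j f))) - mu (P 0 0 (Q 0 t (j f))).
  by rewrite Q1 ?t0// P1 ?lexx.
apply: (@le_trans _ _ (M0 * c3 * c2 * e * `|f| * (t - 0))); last first.
  rewrite subr0 -!mulrA; do 3 (rewrite ler_wpM2l ?M0_ge0 ?(ltW c2_gt0) ?(ltW c3_gt0)//).
  by rewrite [leRHS]mulrC -!mulrA ler_wpM2l// ler_wpM2l.
(* [P 0 x] contributes [LP x] and [Q x t] contributes [- LQ x], so that only the difference of the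
   generators remains. It acts on [QD x t f], which lies in [D] by invariance. *)
apply: (@mean_value_le _ 0 t _ (fun x => mu (P 0 x (Q x t (j f))))
  (fun x => mu (P 0 x ((LP x - LQ x) (QD x t f))))) => // x /andP[x0 xt].
  apply: has_derivative_within_linear.
  have xT := le_trans xt tT.
  have -> : P 0 x ((LP x - LQ x) (QD x t f)) =
      P 0 x (- LQ x (QD x t f)) + P 0 x (LP x (QD x t f)).
    by rewrite -linearD addrC.
  apply: (@has_derivative_within_apply _ _ _ _ (P 0) _ _ _ _ c3).
  - by move=> y; rewrite /= in_itv /= => /andP[y0 yt]; rewrite Pc// (le_trans yt).
  - move=> z; have := @propagator_cvg _ z x Pcont; rewrite x0 xT => /(_ isT).
    apply: cvg_trans; apply: cvg_app; apply: within_subset => y.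
    by rewrite /= !in_itv /= => /andP[-> /le_trans ->].
  - exact: Ql.
  - rewrite QQD//; apply: has_derivative_withinS (Pr _ 0 x _ x0 xT) => // y.
    by rewrite /= !in_itv /= => /andP[-> /le_trans ->].
have xT := le_trans xt tT.
apply: le_trans (mu_le _) _; rewrite -!mulrA ler_wpM2l ?M0_ge0//.
apply: le_trans (bop_le _ (Pc 0 x _ x0 xT)) _ => //; rewrite ler_wpM2l ?(ltW c3_gt0)//.
apply: (@le_trans _ _ (e * `|QD x t f|)).
  by apply: bop_le; apply: LPQ; rewrite x0.
by rewrite mulrCA ler_wpM2l//; apply: bop_le; exact: Qc.
Qed.

Lemma curves_convex : convex_set (M : set (convex_lmodType (dual B))) ->
  forall xi eta a, curves j M T mu xi -> curves j M T mu eta -> 0 <= a <= 1 ->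
  curves j M T mu (a *: xi + (1 - a) *: eta).
Proof.
move=> M_convex xi eta a [xiM xic xi0] [etaM etac eta0] /andP[a0 a1]; split.
- move=> t t0T; have := M_convex (xi t) (eta t) (Itv01 a0 a1).
  by rewrite !inE => /(_ (xiM t t0T) (etaM t t0T)).
- move=> x; rewrite /= (_ : (fun t => _) =
    (fun t => a *: adjoint j (xi t) + (1 - a) *: adjoint j (eta t))).
    by apply: cvgD; apply: cvgZr; [exact: xic|exact: etac].
  by apply/funext => t; rewrite -!adjointZ -adjointD.
- have -> : (a *: xi + (1 - a) *: eta) 0 = a *: xi 0 + (1 - a) *: eta 0 by [].
  by rewrite xi0 eta0 -scalerDl subrKC scale1r.
Qed.

Lemma lipschitz_curve (xi : R -> dual B) (L : R) : 0 <= L ->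
  (forall t, 0 <= t <= T -> M (xi t)) -> xi 0 = mu ->
  (forall s t, 0 <= s <= T -> 0 <= t <= T ->
    `|adjoint j (xi t - xi s)| <= L * `|t - s|) ->
  curves j M T mu xi.
Proof.
move=> L0 xiM xi0 xiL; split=> //; apply/subspace_continuousP => s.
rewrite /= in_itv /= => s0T; apply/cvgrPdist_lt => e e0.
have L1 : 0 < L + 1 by rewrite ltr_wpDl.
have : \forall t \near s, `|s - t| < e / (L + 1).
  by have := nbhsx_ballx s _ (divr_gt0 e0 L1); rewrite -ball_normE.
rewrite near_withinE; apply: filterS => t st; rewrite /= in_itv /= => t0T.
rewrite -adjointB; apply: le_lt_trans (xiL _ _ t0T s0T) _.
apply: (@le_lt_trans _ _ ((L + 1) * `|s - t|)); first by rewrite ler_wpM2r// lerDl.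
by rewrite mulrC -ltr_pdivlMr.
Qed.

(** Limits are taken in the dual of [D], and closedness of the image of [M] brings them back to
    functionals on [B]. The common Lipschitz constant passes to the limit and makes it a continuous
    curve. *)
Lemma curve_limit (H : set_system nat) (eta : nat -> R -> dual B) (L : R) :
  ProperFilter H -> dense (range j) -> closed (adjoint j @` M) -> 0 <= L ->
  (forall k t, 0 <= t <= T -> M (eta k t)) -> (forall k, eta k 0 = mu) ->
  (forall k s t, 0 <= s <= T -> 0 <= t <= T ->
    `|adjoint j (eta k t - eta k s)| <= L * `|t - s|) ->
  (forall e, 0 < e -> exists i, \forall k \near H, forall t, 0 <= t <= T ->
    `|adjoint j (eta i t - eta k t)| <= e) ->
  exists2 nu, curves j M T mu nu & forall e, 0 < e -> \forall k \near H,
    forall t, 0 <= t <= T -> `|adjoint j (eta k t - nu t)| <= e.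
Proof.
move=> HF j_dense M_closed L0 etaM eta0 etaL eta_cauchy.
have lim t : 0 <= t <= T ->
    exists2 nu, M nu & adjoint j (eta k t) @[k --> H] --> adjoint j nu.
  move=> t0T; have [e e0|l etal] := @bop_cvg R D R^o nat H
    (fun k => adjoint j (eta k t)) HF.
    have [i ie] := eta_cauchy e e0; exists (adjoint j (eta i t)).
    by apply: filterS ie => k /(_ t t0T); rewrite adjointB.
  have [nu Mnu nul] : (adjoint j @` M) l.
    apply: (closed_cvg _ M_closed) etal; apply: nearW => k.
    by exists (eta k t) => //; exact: etaM.
  by exists nu => //; rewrite nul.
pose nu t := if pselect (0 <= t <= T) is left t0T then s2val (cid2 (lim t t0T)) else mu.
have nuM t : 0 <= t <= T -> M (nu t).
  by move=> t0T; rewrite /nu; case: pselect => // ?; case: cid2.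
have nu_cvg t : 0 <= t <= T ->
    adjoint j (eta k t) @[k --> H] --> adjoint j (nu t).
  by move=> t0T; rewrite /nu; case: pselect => // ?; case: cid2.
exists nu.
  apply: (@lipschitz_curve _ L) => //.
    apply: (adjoint_inj j_dense).
    have := nu_cvg 0; rewrite lexx (ltW T_gt0) => /(_ isT).
    under eq_fun do rewrite eta0.
    by move=> cst; apply: (cvg_unique _ cst (cvg_cst _)).
  move=> s t s0T t0T; rewrite adjointB.
  apply: (@cvgr_to_le _ H _ _ (fun k => `|adjoint j (eta k t) - adjoint j (eta k s)|)).
    by apply: cvg_norm; apply: cvgB; exact: nu_cvg.
  by apply: nearW => k; rewrite -adjointB; exact: etaL.
move=> e e0; have [i ie] := eta_cauchy (e / 2) (divr_gt0 e0 (ltr0Sn _ _)).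
have inu t : 0 <= t <= T -> `|adjoint j (eta i t - nu t)| <= e / 2.
  move=> t0T; rewrite adjointB.
  apply: (@cvgr_to_le _ H _ _ (fun k => `|adjoint j (eta i t) - adjoint j (eta k t)|)).
    by apply: cvg_norm; apply: cvgB; [exact: cvg_cst|exact: nu_cvg].
  by apply: filterS ie => k /(_ t t0T); rewrite adjointB.
apply: filterS ie => k ie t t0T; rewrite adjointB.
rewrite (le_trans (ler_distD (adjoint j (eta i t)) _ _))// [leRHS]splitr.
by rewrite lerD// -adjointB; [rewrite adjointB distrC -adjointB|]; auto.
Qed.

End SolutionMap.

(** * Existence of a solution *)

Theorem theorem2p4 (R : realType) (B D : completeNormedModType R)
  (j : bop D B) (j_inj : injective j) (j_dense : dense (range j))
  (j_norm : forall f : D, `|j f| <= `|f|)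
  (M : set (dual B)) (M0 : R)
  (M_convex : convex_set (M : set (convex_lmodType (dual B))))
  (M_bounded : forall nu, M nu -> `|nu| <= M0)
  (M_closedB : closed M) (M_closedD : closed (adjoint j @` M))
  (T : R) (T_gt0 : 0 < T) (mu : dual B) (M_mu : M mu)
  (A : R -> (R -> dual B) -> bop D B)
  (c1 : R) (c1_gt0 : 0 < c1)
  (A_lipschitz : forall xi eta,
    curves j M T mu xi -> curves j M T mu eta ->
    (ereal_sup [set (`|A t xi - A t eta|)%:E | t in `[0%R, T]]
       <= c1%:E * curve_dist j T xi eta)%E)
  (A_bounded : forall xi, curves j M T mu xi ->
    (ereal_sup [set (`|A t xi|)%:E | t in `[0%R, T]] <= c1%:E)%E)
  (c2 c3 : R) (c2_gt0 : 0 < c2) (c3_gt0 : 0 < c3)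
  (U : (R -> dual B) -> R -> R -> bop B B)
  (UD : (R -> dual B) -> R -> R -> bop D D)
  (U_propagator : forall xi, curves j M T mu xi ->
    backward_propagator T (U xi) /\ strongly_continuous T (U xi))
  (U_generated : forall xi, curves j M T mu xi ->
    generates j T (A^~ xi) (U xi) (UD xi))
  (U_boundedD : forall xi, curves j M T mu xi ->
    forall t s, 0 <= t -> t <= s -> s <= T -> `|UD xi t s| <= c2)
  (U_boundedB : forall xi, curves j M T mu xi ->
    forall t s, 0 <= t -> t <= s -> s <= T -> `|U xi t s| <= c3)
  (U_dual : forall xi, curves j M T mu xi ->
    forall t s, 0 <= t -> t <= s -> s <= T ->
    forall nu, M nu -> M (adjoint (U xi t s) nu))
  (S : set R) (S_sub : S `<=` `[0, T]) (S_dense : `[0, T] `<=` closure S)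
  (S_compact : forall t, S t ->
    precompact [set adjoint j (adjoint (U xi 0 t) mu)
               | xi in curves j M T mu]) :
  exists mu_ : R -> dual B,
    curves j M T mu mu_ /\
    forall (f : D) (t : R), 0 <= t <= T ->
      has_derivative_within `[0, T] (fun s => mu_ s (j f) : R^o) t
        (mu_ t (A t mu_ f)).
Proof.
have M00 : 0 <= M0 := M0_ge0 M_mu M_bounded.
have T0 := ltW T_gt0.
pose K := curves j M T mu.
pose Phi (xi : R -> dual B) t := adjoint (U xi 0 t) mu.
have Ac xi : K xi -> forall t, 0 <= t <= T -> `|A t xi| <= c1.
  move=> Kxi t t0T; rewrite -lee_fin; apply: le_trans (A_bounded _ Kxi).
  by apply: ereal_sup_ubound; exists t => //=; rewrite in_itv.
have Alip xi eta e : K xi -> K eta ->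
    (forall t, 0 <= t <= T -> `|adjoint j (xi t - eta t)| <= e) ->
    forall t, 0 <= t <= T -> `|A t xi - A t eta| <= c1 * e.
  move=> Kxi Keta xe t t0T; rewrite -lee_fin.
  apply: (@le_trans _ _ (c1%:E * curve_dist j T xi eta)%E).
    apply: le_trans (A_lipschitz _ _ Kxi Keta).
    by apply: ereal_sup_ubound; exists t => //=; rewrite in_itv.
  rewrite EFinM lee_pmul2l ?lte_fin//; apply: ge_ereal_sup => _ [s + <-].
  by rewrite /= in_itv /= lee_fin; exact: xe.
pose L := M0 * c3 * c1.
have L0 : 0 <= L by rewrite !mulr_ge0// ltW.
have PhiLt xi : K xi -> forall s t, 0 <= s <= T -> 0 <= t <= T ->
    `|adjoint j (Phi xi t - Phi xi s)| <= L * `|t - s|.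
  move=> Kxi; apply: (solution_lipschitz_time M_mu M_bounded _ _ (U_generated _ Kxi)) => //.
  - exact: Ac.
  - exact: U_boundedB.
have Phi0 xi : K xi -> Phi xi 0 = mu.
  move=> Kxi; rewrite /Phi (U_propagator _ Kxi).1.1 ?lexx//.
  exact/val_inj.
have PhiM xi t : K xi -> 0 <= t <= T -> M (Phi xi t).
  by move=> Kxi /andP[t0 tT]; apply: U_dual => //; rewrite lexx.
have PhiK xi : K xi -> K (Phi xi).
  move=> Kxi; apply: (lipschitz_curve L0) => [t t0T||].
  - exact: PhiM.
  - exact: Phi0.
  - exact: PhiLt.
pose Lip := M0 * c3 * c2 * T * c1.
have Lip0 : 0 <= Lip by rewrite !mulr_ge0// ltW.
have PhiL xi eta e : K xi -> K eta ->
    (forall t, 0 <= t <= T -> `|adjoint j (xi t - eta t)| <= e) ->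
    forall t, 0 <= t <= T -> `|adjoint j (Phi xi t - Phi eta t)| <= Lip * e.
  move=> Kxi Keta xe t t0T; rewrite -mulrA.
  have [P1 P2] := U_propagator _ Kxi.
  apply: (solution_lipschitz M_mu M_bounded _ _ _ P1 P2 (U_generated _ Kxi)
    (U_propagator _ Keta).1 (U_generated _ Keta)) => //.
  - exact: Alip.
  - exact: U_boundedB.
  - exact: U_boundedD.
have colouring e : 0 < e -> exists (F : finType) (c : (R -> dual B) -> F),
    forall xi eta, K xi -> K eta -> c xi = c eta ->
    forall t, 0 <= t <= T -> `|adjoint j (Phi xi t - Phi eta t)| <= e.
  move=> e0; have e3 : 0 < e / 3 by rewrite divr_gt0.
  (* Between a time and a nearby point of a net of mesh [e / 3 / (L + 1)] every curve [Phi xi] moves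
     by at most [e / 3]. The added 1 is there because [L] may vanish. *)
  have L1 : 0 < L + 1 by rewrite ltr_wpDl.
  have [l [lS lnet]] := dense_net (divr_gt0 e3 L1) S_dense.
  have [|F [c cP]] := @colouring_seq _ _ K (fun t xi eta =>
      `|adjoint j (Phi xi t) - adjoint j (Phi eta t)| <= e / 3) l.
    move=> t /lS/S_compact/(precompact_colouring e3)[F [c cP]].
    exists F, (fun xi => c (adjoint j (Phi xi t))) => xi eta Kxi Keta.
    by apply: cP; [exists xi|exists eta].
  exists F, c => xi eta Kxi Keta cxy t t0T.
  have [s sl ts] := lnet t t0T.
  have s0T : 0 <= s <= T by have := S_sub _ (lS s sl); rewrite /= in_itv.
  have near_s zeta : K zeta -> `|adjoint j (Phi zeta t - Phi zeta s)| <= e / 3.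
    move=> Kz; apply: le_trans (PhiLt _ Kz _ _ s0T t0T) _.
    apply: (@le_trans _ _ ((L + 1) * (e / 3 / (L + 1)))).
      by rewrite ler_pM// lerDl.
    by rewrite mulrC divfK ?gt_eqF.
  rewrite adjointB (_ : e = e / 3 + (e / 3 + e / 3)); last by field.
  apply: (ler_dist_chain (y := adjoint j (Phi xi s))).
    by rewrite -adjointB; exact: near_s.
  apply: (ler_dist_chain (y := adjoint j (Phi eta s))); first exact: cP.
  by rewrite distrC -adjointB; exact: near_s.
(* Only times in [[0, T]] serve as indices, since curves are unconstrained elsewhere. *)
pose q (t : {t : R | 0 <= t <= T}) (xi : R -> dual B) := `|adjoint j (xi (val t))|.
have Kmu : K (fun=> mu).
  apply: (lipschitz_curve (L := 0)) => // s t _ _.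
  by rewrite adjointB subrr normr0 mul0r.
have approx e : 0 < e -> exists2 xi, K xi &
    forall t, 0 <= t <= T -> `|adjoint j (Phi xi t - xi t)| <= 2 * e.
  move=> e0; have [F [c cP]] := colouring e e0.
  have [||||||||||xi Kxi xiP] := @approximate_fixed_point _ _ _ q _ _ K M0 Phi Lip
    (fun=> mu) _ _ _ _ _ _ _ e F c e0.
  - by move=> t xi eta; rewrite /q adjointD ler_normD.
  - by move=> t a xi; rewrite /q adjointZ normrZ.
  - exact: curves_convex.
  - exact: M00.
  - move=> xi [xiM _ _] [t t0T]; apply: le_trans (adjoint_norm_le _ j_norm) _.
    by apply: M_bounded; exact: xiM.
  - exact: PhiK.
  - exact: Lip0.
  - move=> xi eta d Kxi Keta xd [t t0T]; apply: PhiL => // s s0T.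
    exact: xd (exist _ s s0T).
  - exact: Kmu.
  - by move=> xi eta Kxi Keta cxy [t t0T]; exact: cP.
  - by exists xi => // t t0T; exact: xiP (exist _ t t0T).
have /choice[xi xiP] : forall k : nat, exists xi, K xi /\
    forall t, 0 <= t <= T -> `|adjoint j (Phi xi t - xi t)| <= 2 * k.+1%:R^-1.
  by move=> k; have [|xi] := approx k.+1%:R^-1; [rewrite invr_gt0|exists xi].
have Kxi k := (xiP k).1.
have [H [UH Hoo]] := ultraFilterLemma eventually_filter.
have [|||e e0|nu Knu nuP] := @curve_limit _ _ _ j M T mu M_mu T_gt0 H
  (fun k => Phi (xi k)) L _ j_dense M_closedD L0.
- by move=> k t; exact: PhiM.
- by move=> k; exact: Phi0.
- by move=> k; exact: PhiLt.
(* Almost all [xi k] along [H] share one colour, so their images are [e]-close to that of any one of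
   them: this is the Cauchy condition. *)
- have [F [c cP]] := colouring e e0.
  have [f cf] := ultra_colour (fun k => c (xi k)) UH.
  have [i ci] := filter_ex cf; exists i; apply: filterS cf => k ck.
  by apply: cP => //; rewrite ci ck.
have fixed t : 0 <= t <= T -> nu t = Phi nu t.
  move=> t0T; apply: (adjoint_inj j_dense); apply/eqP.
  rewrite -subr_eq0 -adjointB -normr_le0; apply/ler_addgt0Pl => d d0.
  rewrite addr0; have C0 : 0 < 3 * Lip + 1 by rewrite ltr_wpDl// mulr_ge0.
  (* [xi k] is within [2 * e] of its image, itself within [e] of [nu]. The final error
     [e + Lip * (3 * e)] is then exactly [d]. *)
  pose e := d / (3 * Lip + 1); have e0 : 0 < e by rewrite divr_gt0.
  have small : \forall k \near H, k.+1%:R^-1 < e.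
    exact/Hoo/(near_infty_natSinv_lt (PosNum e0)).
  have [k [ke nuk]] := filter_ex (filterI small (nuP e e0)).
  have xik s : 0 <= s <= T -> `|adjoint j (xi k s - nu s)| <= 3 * e.
    move=> s0T; rewrite adjointB (_ : 3 * e = 2 * e + e); last by ring.
    apply: (ler_dist_chain (y := adjoint j (Phi (xi k) s))); last first.
      by rewrite -adjointB; exact: nuk.
    rewrite distrC -adjointB; apply: le_trans ((xiP k).2 s s0T) _.
    by rewrite ler_wpM2l// ltW.
  rewrite adjointB (_ : d = e + Lip * (3 * e)); last first.
    by rewrite /e; field; exact: lt0r_neq0.
  apply: (ler_dist_chain (y := adjoint j (Phi (xi k) t))).
    by rewrite distrC -adjointB; exact: nuk.
  by rewrite -adjointB; exact: PhiL.
(* Applying [mu] to the equation for [U nu 0 t] in its second time gives the Cauchy problem for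
   [Phi nu], which agrees with [nu] on [[0, T]]. *)
exists nu; split=> // f t t0T.
have [_ _ + _] := U_generated _ Knu; have /andP[t0 tT] := t0T.
move=> /(_ f 0 t (lexx 0) t0 tT) /(has_derivative_within_linear (u := mu)).
rewrite fixed//; apply: has_derivative_within_eq.
  by rewrite /= in_itv.
by move=> s; rewrite /= in_itv /= => s0T; rewrite fixed.
Qed.
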